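(* Let $\Phi=(A;\{E_i\}_{i=0}^d;A^*;\{E^*_i\}_{i=0}^d)$ be a tridiagonal system on $V$ with $d\ge1$, eigenvalue sequence $\{\theta_i\}_{i=0}^d$ and dual eigenvalue sequence $\{\theta^*_i\}_{i=0}^d$. Let $\mathcal R,\mathcal L$ be the $\Phi$-split raising and lowering maps and $\{F_i\}_{i=0}^d$ the projections for the $\Phi$-split decomposition. For $0\le i,j\le d$ such that $j-i\ge2$, the following holds on $F_iV$: $$\begin{aligned}0&=\sum_{i\le s\le j}\theta^*_s\frac{\mathcal R^{j-s}}{(\theta_j-\theta_s)(\theta_j-\theta_{s+1})\cdots(\theta_j-\theta_{j-1})}\;\frac{\mathcal R^{s-i}}{(\theta_i-\theta_s)(\theta_i-\theta_{s-1})\cdots(\theta_i-\theta_{i+1})}\\&\quad+\sum_{\substack{i\le r\le d,\\ 0\le s\le j,\\ {r-s=1}}}\frac{\mathcal R^{j-s}}{(\theta_j-\theta_s)(\theta_j-\theta_{s+1})\cdots(\theta_j-\theta_{j-1})}\;\mathcal L\;\frac{\mathcal R^{r-i}}{(\theta_i-\theta_r)(\theta_i-\theta_{r-1})\cdots(\theta_i-\theta_{i+1})}.\end{aligned}$$ Here empty products equal $1$.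
   Context: Let $\mathbb F$ be a field and $V$ a nonzero finite-dimensional vector space over $\mathbb F$; $\mathrm{End}(V)$ is the algebra of $\mathbb F$-linear maps $V\to V$, with identity $I$. A tridiagonal pair on $V$ is an ordered pair $A,A^*\in\mathrm{End}(V)$ such that: (1) each of $A,A^*$ is diagonalizable; (2) there is an ordering $\{V_i\}_{i=0}^d$ of the eigenspaces of $A$ with $A^*V_i\subseteq V_{i-1}+V_i+V_{i+1}$ $(0\le i\le d)$, where $V_{-1}=V_{d+1}=0$; (3) there is an ordering $\{V^*_i\}_{i=0}^\delta$ of the eigenspaces of $A^*$ with $AV^*_i\subseteq V^*_{i-1}+V^*_i+V^*_{i+1}$ $(0\le i\le\delta)$, where $V^*_{-1}=V^*_{\delta+1}=0$; (4) there is no subspace $W\subseteq V$ with $W\ne0$, $W\ne V$, $AW\subseteq W$, $A^*W\subseteq W$. It is known that $d=\delta$. Orderings as in (2), (3) are called standard. For a diagonalizable map, the primitive idempotent attached to an eigenspace is the projection onto that eigenspace that vanishes on the other eigenspaces; an ordering of primitive idempotents is standard if the corresponding ordering of eigenspaces is. A tridiagonal system on $V$ is a sequence $\Phi=(A;\{E_i\}_{i=0}^d;A^*;\{E^*_i\}_{i=0}^d)$ where $A,A^*$ is a tridiagonal pair on $V$, $\{E_i\}$ is a standard ordering of the primitive idempotents of $A$, and $\{E^*_i\}$ is a standard ordering of the primitive idempotents of $A^*$. Let $\theta_i$ (resp. $\theta^*_i$) be the eigenvalue of $A$ (resp. $A^*$) for $E_i$ (resp. $E^*_i$); $\{\theta_i\}_{i=0}^d$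 and $\{\theta^*_i\}_{i=0}^d$ are the eigenvalue and dual eigenvalue sequences. Throughout $d\ge1$. $\Phi$-split decomposition: $U_i=(E^*_0V+\cdots+E^*_iV)\cap(E_iV+\cdots+E_dV)$ for $0\le i\le d$; it is known that $V=\sum_{i=0}^dU_i$ is a direct sum. $F_i\in\mathrm{End}(V)$ is the projection onto $U_i$ with $F_iU_j=0$ for $j\ne i$ (so $F_iV=U_i$). Define $\mathcal R=A-\sum_{i=0}^d\theta_iF_i$ (the $\Phi$-split raising map) and $\mathcal L=A^*-\sum_{i=0}^d\theta^*_iF_i$ (the $\Phi$-split lowering map). It is known that $\mathcal RF_iV\subseteq F_{i+1}V$, $\mathcal LF_iV\subseteq F_{i-1}V$ (with $F_{-1}V=F_{d+1}V=0$). *)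

(* Defs.v *)
From HB Require Import structures.
From mathcomp Require Import all_boot all_order all_algebra.

Set Implicit Arguments.
Unset Strict Implicit.
Unset Printing Implicit Defensive.

Import GRing.Theory passmx.
Local Open Scope ring_scope.

Section TridiagonalSystems.
Variables (F : fieldType) (V : vectType F).

Definition diagonalizable_end (A : 'End(V)) : Prop :=
  exists X : seq V, basis_of fullv X
    /\ forall x, x \in X -> exists a : F, A x = a *: x.

Definition is_eigenspace (A : 'End(V)) (W : {vspace V}) : Prop :=
  exists2 a : F, leigenvalue A a & W = leigenspace A a.

Definition eigenspace_ordering (A : 'End(V)) (d : nat)
    (W : 'I_d.+1 -> {vspace V}) : Prop :=
  injective W /\ forall U, is_eigenspace A U <-> exists i, U = W i.

(* The sum below is W_{i-1} + W_i + W_{i+1}; restricting it to the indices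
   that exist encodes the convention W_{-1} = W_{d+1} = 0. *)
Definition standard_ordering (A B : 'End(V)) (d : nat)
    (W : 'I_d.+1 -> {vspace V}) : Prop :=
  eigenspace_ordering A W
  /\ forall i : 'I_d.+1,
       (B @: W i <= \sum_(k < d.+1 | ((k <= i.+1) && (i <= k.+1))%N) W k)%VS.

Definition tridiagonal_pair (A As : 'End(V)) : Prop :=
  [/\ diagonalizable_end A /\ diagonalizable_end As,
      exists (d : nat) (W : 'I_d.+1 -> {vspace V}), standard_ordering A As W,
      exists (delta : nat) (W : 'I_delta.+1 -> {vspace V}),
        standard_ordering As A W
    & ~ exists W : {vspace V},
          [/\ W <> 0%VS, W <> fullv, (A @: W <= W)%VS & (As @: W <= W)%VS]].

(* E is the primitive idempotent of A attached to the eigenspace of a. *)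
Definition primitive_idempotent_for (A : 'End(V)) (a : F) (E : 'End(V)) : Prop :=
  [/\ leigenvalue A a,
      limg E = leigenspace A a,
      forall v, v \in leigenspace A a -> E v = v
    & forall b, b != a -> forall v, v \in leigenspace A b -> E v = 0].

Definition primitive_idempotent (A E : 'End(V)) : Prop :=
  exists a : F, primitive_idempotent_for A a E.

Definition idempotent_ordering (A : 'End(V)) (d : nat)
    (E : 'I_d.+1 -> 'End(V)) : Prop :=
  injective E /\ forall P, primitive_idempotent A P <-> exists i, P = E i.

Definition standard_idempotents (A B : 'End(V)) (d : nat)
    (E : 'I_d.+1 -> 'End(V)) : Prop :=
  idempotent_ordering A E /\ standard_ordering A B (fun i => limg (E i)).

Definition tridiagonal_system (d : nat) (A : 'End(V)) (E : 'I_d.+1 -> 'End(V))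
    (As : 'End(V)) (Es : 'I_d.+1 -> 'End(V)) : Prop :=
  [/\ tridiagonal_pair A As,
      standard_idempotents A As E
    & standard_idempotents As A Es].

Definition eigenvalue_sequence (d : nat) (A : 'End(V)) (E : 'I_d.+1 -> 'End(V))
    (theta : 'I_d.+1 -> F) : Prop :=
  forall i, primitive_idempotent_for A (theta i) (E i).

Definition split_space (d : nat) (E Es : 'I_d.+1 -> 'End(V)) (i : 'I_d.+1) :
    {vspace V} :=
  ((\sum_(k < d.+1 | (k <= i)%N) limg (Es k))
     :&: (\sum_(k < d.+1 | (i <= k)%N) limg (E k)))%VS.

Definition split_projections (d : nat) (E Es : 'I_d.+1 -> 'End(V))
    (P : 'I_d.+1 -> 'End(V)) : Prop :=
  forall i,
    [/\ limg (P i) = split_space E Es i,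
        forall v, v \in split_space E Es i -> P i v = v
      & forall j, j != i -> forall v, v \in split_space E Es j -> P i v = 0].

Definition split_raising (d : nat) (A : 'End(V)) (theta : 'I_d.+1 -> F)
    (P : 'I_d.+1 -> 'End(V)) : 'End(V) :=
  A - \sum_(i < d.+1) theta i *: P i.

Definition split_lowering (d : nat) (As : 'End(V)) (thetas : 'I_d.+1 -> F)
    (P : 'I_d.+1 -> 'End(V)) : 'End(V) :=
  As - \sum_(i < d.+1) thetas i *: P i.

End TridiagonalSystems.

(* Main.v *)
Require Import Defs.
From mathcomp Require Import all_boot all_order all_algebra.
Import GRing.Theory passmx.
Local Open Scope ring_scope.

(** For [v] in [U_i], the vector
    [w = \sum_(r >= i) R^(r-i) v / ((theta_i - theta_r) ... (theta_i - theta_(i+1)))]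
    lies in [E_i V], because [A] acts on [U_r] as [theta_r + R]. Dually, the map
    [G = \sum_(s <= j) R^(j-s) F_s / ((theta_j - theta_s) ... (theta_j - theta_(j-1)))]
    satisfies [G A = theta_j G], so it vanishes on [E_k V] for [k <> j]. As
    [A* w] lies in [E_(i-1) V + E_i V + E_(i+1) V] and [j - i >= 2], we get
    [G A* w = 0]; the formula is this equation with [A*] acting on [U_r] as
    [theta*_r + L]. *)

(** * Partial sums of a family of subspaces under tridiagonal and diagonal actions *)

Section Flags.
Set Implicit Arguments.
Unset Strict Implicit.
Variables (K : fieldType) (V : vectType K) (n : nat) (B : 'End(V)).
Variable W : 'I_n -> {vspace V}.

Lemma memv_sum_subpred (P Q : pred 'I_n) (x : V) :
  subpred P Q -> x \in (\sum_(k < n | P k) W k)%VS ->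
  x \in (\sum_(k < n | Q k) W k)%VS.
Proof.
move=> PQ; apply/subvP/subv_sumP => k Pk; exact: sumv_sup (PQ k Pk) (subvv _).
Qed.

(** Each summand spreads only to its neighbours, so an initial or final segment of indices grows by
    at most one. *)
Lemma tridiagonal_memv_sum (P Q : pred 'I_n) (x : V) :
  (forall k : 'I_n,
     (B @: W k <= \sum_(l < n | ((l <= k.+1) && (k <= l.+1))%N) W l)%VS) ->
  (forall k l : 'I_n, P k -> (l <= k.+1)%N -> (k <= l.+1)%N -> Q l) ->
  x \in (\sum_(k < n | P k) W k)%VS -> B x \in (\sum_(k < n | Q k) W k)%VS.
Proof.
move=> BW PQ /memv_sumP [y yW ->]; rewrite linear_sum memv_suml // => k Pk.
have /(subvP (BW k)) := memv_img B (yW k Pk).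
by apply: memv_sum_subpred => l /andP[]; exact: PQ.
Qed.

Lemma eigen_memv_sum (t : 'I_n -> K) (m : nat) (a : K) (P Q : pred 'I_n) (x : V) :
  (forall k y, y \in W k -> B y = t k *: y) ->
  (forall k : 'I_n, k = m :> nat -> t k = a) ->
  (forall k : 'I_n, P k -> k != m :> nat -> Q k) ->
  x \in (\sum_(k < n | P k) W k)%VS ->
  B x - a *: x \in (\sum_(k < n | Q k) W k)%VS.
Proof.
move=> BW tm PQ /memv_sumP [y yW ->].
rewrite linear_sum /= scaler_sumr -sumrB memv_suml // => k Pk.
rewrite (BW k _ (yW k Pk)) -scalerBl.
have [km|km] := eqVneq (k : nat) m; first by rewrite (tm k km) subrr scale0r mem0v.
apply: memvZ; exact: (subvP (sumv_sup k (PQ k Pk km) (subvv (W k)))) (yW k Pk).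
Qed.

End Flags.

Lemma iter_comp_lfunE (K : fieldType) (V : vectType K) (f : 'End(V)) n x :
  iter n (comp_lfun f) \1%VF x = iter n f x.
Proof. by elim: n => [|n IH] /=; rewrite ?id_lfunE // comp_lfunE IH. Qed.

Lemma leigenspaceP (K : fieldType) (V : vectType K) (f : 'End(V)) a x :
  reflect (f x = a *: x) (x \in leigenspace f a).
Proof.
rewrite memv_ker add_lfunE opp_lfunE scale_lfunE id_lfunE subr_eq0; exact: eqP.
Qed.

Section TridiagonalSystem.
Set Implicit Arguments.
Unset Strict Implicit.
Variables (K : fieldType) (V : vectType K) (d : nat).
Variables (A As : 'End(V)) (E Es : 'I_d.+1 -> 'End(V)).
Variables (theta thetas : 'I_d.+1 -> K) (F : 'I_d.+1 -> 'End(V)).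
Hypothesis Phi : tridiagonal_system A E As Es.
Hypothesis theta_eig : eigenvalue_sequence A E theta.
Hypothesis thetas_eig : eigenvalue_sequence As Es thetas.
Hypothesis F_proj : split_projections E Es F.

Let R := split_raising A theta F.
Let L := split_lowering As thetas F.

(** * Eigenvalues, and the action of [R] and [L] on the split decomposition *)

Lemma limg_eig k x : x \in limg (E k) -> A x = theta k *: x.
Proof. by case: (theta_eig k) => _ -> _ _ /leigenspaceP. Qed.

Lemma limgs_eig k x : x \in limg (Es k) -> As x = thetas k *: x.
Proof. by case: (thetas_eig k) => _ -> _ _ /leigenspaceP. Qed.

Lemma theta_inj : injective theta.
Proof.
case: Phi => _ [_ [[Winj _] _]] _ k l kl; apply: Winj.
by case: (theta_eig k) (theta_eig l) => _ -> _ _ [_ -> _ _]; rewrite kl.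
Qed.

(* Indexing by [nat] gives [split_nat d.+1 = 0], i.e. [U_(d+1) = 0]. *)
Definition split_nat (n : nat) : {vspace V} :=
  ((\sum_(k < d.+1 | (k <= n)%N) limg (Es k))
     :&: (\sum_(k < d.+1 | (n <= k)%N) limg (E k)))%VS.

Lemma split_nat_gt n x : (d < n)%N -> x \in split_nat n -> x = 0.
Proof.
move=> dn /memv_capP [_]; rewrite big1 ?memv0; first by move/eqP.
by move=> k; rewrite leqNgt (leq_trans (ltn_ord k) dn).
Qed.

Lemma F_id (k : 'I_d.+1) x : x \in split_nat k -> F k x = x.
Proof. by case: (F_proj k) => _ + _; apply. Qed.

Lemma F_neq (k l : 'I_d.+1) x : x \in split_nat k -> l != k -> F l x = 0.
Proof. by rewrite eq_sym => xU lk; case: (F_proj l) => _ _ /(_ k lk); apply. Qed.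

Lemma sum_F_split (t : 'I_d.+1 -> K) (k : 'I_d.+1) x :
  x \in split_nat k -> (\sum_(l < d.+1) t l *: F l) x = t k *: x.
Proof.
move=> xU; rewrite sum_lfunE (bigD1 k) //= scale_lfunE F_id // big1 ?addr0 //.
by move=> l lk; rewrite scale_lfunE (F_neq xU) ?scaler0.
Qed.

Lemma A_split (k : 'I_d.+1) x : x \in split_nat k -> A x = theta k *: x + R x.
Proof.
by move=> xU; rewrite /R /split_raising add_lfunE opp_lfunE (sum_F_split _ xU) addrC subrK.
Qed.

Lemma As_split (k : 'I_d.+1) x : x \in split_nat k -> As x = thetas k *: x + L x.
Proof.
by move=> xU; rewrite /L /split_lowering add_lfunE opp_lfunE (sum_F_split _ xU) addrC subrK.
Qed.

(** On [U_n] the map [R] is [A - theta_n]: tridiagonality widens the [Es] flag by one, and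
    subtracting [theta_n] removes the component in [E_n V]. For [n = d] this says that [R x = 0]. *)
Lemma R_split (n : nat) x : (n <= d)%N -> x \in split_nat n -> R x \in split_nat n.+1.
Proof.
rewrite -ltnS => nd xU; pose k := Ordinal nd; have xUk : x \in split_nat k by [].
have -> : R x = A x - theta k *: x by rewrite (A_split xUk) addrC addKr.
case/memv_capP: xU => x1 x2; apply/memv_capP; split.
  apply: memvB; last first.
    by apply: memvZ; apply: memv_sum_subpred x1 => l /leqW.
  apply: tridiagonal_memv_sum x1; first by case: Phi => _ _ [_ []].
  by move=> a b an ba _; rewrite (leq_trans ba).
apply: (eigen_memv_sum (m := n) limg_eig) x2.
  by move=> l ln; congr theta; apply: val_inj.
by move=> l nl ln; rewrite ltn_neqAle eq_sym ln.
Qed.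

Lemma L_split0 x : x \in split_nat 0 -> L x = 0.
Proof.
move=> xU; have xU0 : x \in split_nat (@ord0 d) by [].
have -> : L x = As x - thetas ord0 *: x by rewrite (As_split xU0) addrC addKr.
case/memv_capP: xU => x1 _; apply/eqP; rewrite -memv0.
(* The zero space is written as an empty sum: [As - thetas_0] kills the only summand of the [Es]
   flag. *)
rewrite -(@big_pred0_eq _ 0%VS (@addv K V) _ (index_enum 'I_d.+1) (fun k => limg (Es k))).
apply: (eigen_memv_sum (m := 0%N) limgs_eig) x1.
  by move=> l l0; congr thetas; apply: val_inj.
by move=> l; rewrite leqn0 => ->.
Qed.

(** Dually, [As - thetas_(n+1)] removes the top summand of the [Es] flag, and tridiagonality extends
    the [E] flag downwards by one. *)
Lemma L_split (n : nat) x : (n < d)%N -> x \in split_nat n.+1 -> L x \in split_nat n.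
Proof.
rewrite -ltnS => nd xU; pose k := Ordinal nd; have xUk : x \in split_nat k by [].
have -> : L x = As x - thetas k *: x by rewrite (As_split xUk) addrC addKr.
case/memv_capP: xU => x1 x2; apply/memv_capP; split.
  apply: (eigen_memv_sum (m := n.+1) limgs_eig) x1.
    by move=> l ln; congr thetas; apply: val_inj.
  by move=> l nl ln; rewrite -ltnS ltn_neqAle ln.
apply: memvB; last first.
  by apply: memvZ; apply: memv_sum_subpred x2 => l /ltnW.
apply: tridiagonal_memv_sum x2; first by case: Phi => _ [_ []].
by move=> a b na _ ab; rewrite -ltnS (leq_trans na).
Qed.

Lemma iter_R_split (n m : nat) x :
  (n + m <= d)%N -> x \in split_nat n -> iter m R x \in split_nat (n + m).
Proof.
elim: m => [|m IH] nm xU; first by rewrite addn0.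
rewrite addnS in nm *; apply: R_split (ltnW nm) _; exact: IH (ltnW nm) xU.
Qed.

(* By irreducibility: this sum is invariant under [A] and [A*]. *)
Lemma sum_split_full (k : 'I_d.+1) x : x \in split_nat k -> x != 0 ->
  (\sum_(l < d.+1) split_nat l)%VS = fullv.
Proof.
set U := (\sum_(l < d.+1) _)%VS => xU x0.
have sub n y : y \in split_nat n -> y \in U.
  have [nd|nd] := ltnP n d.+1; last by move/(split_nat_gt nd) ->; rewrite mem0v.
  exact/subvP/(sumv_sup (Ordinal nd)).
have inv (B : 'End(V)) : (forall (l : 'I_d.+1) y, y \in split_nat l -> B y \in U) ->
    (B @: U <= U)%VS.
  move=> BU; apply/subvP => _ /memv_imgP [y + ->] => /memv_sumP [z zU ->].
  by rewrite linear_sum memv_suml // => l _; exact/BU/zU.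
have AU : (A @: U <= U)%VS.
  apply: inv => l y yU; rewrite (A_split yU) memvD //.
    by apply: memvZ; exact: sub yU.
  by apply: (sub l.+1); apply: R_split => //; rewrite -ltnS.
have AsU : (As @: U <= U)%VS.
  apply: inv => l y yU; rewrite (As_split yU) memvD //.
    by apply: memvZ; exact: sub yU.
  case: {1 2}(nat_of_ord l) (ltn_ord l) yU => [|n] ln yU.
    by rewrite (L_split0 yU) mem0v.
  by apply: (sub n); exact: L_split.
case: Phi => [[_ _ _ irr] _ _]; apply/eqP/contraT => /eqP Ufull; case: irr.
by exists U; split=> // U0; have := sub k x xU; rewrite U0 memv0 (negPf x0).
Qed.

(** * The coefficients, and the eigenvector [w] of [A] ([raise_eig]) *)

Definition raise_coef (i : 'I_d.+1) (r : nat) : K :=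
  (\prod_(k < d.+1 | (i < k <= r)%N) (theta i - theta k))^-1.

Definition lower_coef (j : 'I_d.+1) (s : nat) : K :=
  (\prod_(k < d.+1 | (s <= k < j)%N) (theta j - theta k))^-1.

Lemma theta_subK (a b : 'I_d.+1) (c : K) :
  a != b -> ((theta a - theta b) * c)^-1 * (theta a - theta b) = c^-1.
Proof.
move=> ab; rewrite invfM mulrAC mulVf ?mul1r // subr_eq0.
by apply: contra ab => /eqP /theta_inj ->.
Qed.

Lemma raise_coef_rec (i r : 'I_d.+1) : (i < r)%N ->
  raise_coef i r * (theta i - theta r) = raise_coef i r.-1.
Proof.
move=> ir; rewrite /raise_coef (bigD1 r) /=; last by rewrite ir leqnn.
rewrite theta_subK; last by rewrite -val_eqE /= neq_ltn ir.
congr (_^-1); apply: eq_bigl => k; rewrite -val_eqE /= -andbA; congr andb.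
by rewrite andbC -ltn_neqAle -[in LHS](ltn_predK ir).
Qed.

Lemma lower_coef_rec (j s : 'I_d.+1) : (s < j)%N ->
  lower_coef j s * (theta j - theta s) = lower_coef j s.+1.
Proof.
move=> sj; rewrite /lower_coef (bigD1 s) /=; last by rewrite leqnn.
rewrite theta_subK; last by rewrite -val_eqE /= neq_ltn sj orbT.
congr (_^-1); apply: eq_bigl => k; rewrite -val_eqE /= andbAC; congr andb.
by rewrite andbC eq_sym -ltn_neqAle.
Qed.

Definition raise_eig (i : 'I_d.+1) (v : V) : V :=
  \sum_(r < d.+1 | (i <= r)%N) raise_coef i r *: iter (r - i) R v.

Lemma iter_R_ord (i r : 'I_d.+1) v : (i <= r)%N -> v \in split_nat i ->
  iter (r - i) R v \in split_nat r.
Proof.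
move=> ir vU; have := @iter_R_split i (r - i) v.
by rewrite subnKC //; apply=> //; rewrite -ltnS.
Qed.

Lemma raise_eigP (i : 'I_d.+1) v : v \in split_nat i ->
  A (raise_eig i v) = theta i *: raise_eig i v.
Proof.
move=> vU; apply/eqP; rewrite -subr_eq0 /raise_eig.
(* [g n] is [R] applied to the term of [w] in [U_(n-1)]. The guard matters at [n = i], where the
   formula would give [v] instead of 0. *)
pose g n := if (i < n)%N then raise_coef i n.-1 *: iter (n - i) R v else 0.
have ->: A (\sum_(r < d.+1 | (i <= r)%N) raise_coef i r *: iter (r - i) R v)
       - theta i *: (\sum_(r < d.+1 | (i <= r)%N) raise_coef i r *: iter (r - i) R v)
       = \sum_(0 <= r < d.+1) (g r.+1 - g r).
  rewrite linear_sum scaler_sumr -sumrB big_mkord big_mkcond; apply: eq_bigr => r _.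
  rewrite /g ltnS; case: (leqP i r) => [ir|ri]; last by rewrite ltnNge (ltnW ri) subrr.
  rewrite linearZ /= (A_split (iter_R_ord ir vU)) subSn //= scalerDr addrAC [LHS]addrC.
  congr (_ + _); rewrite !scalerA -scalerBl [theta i * _]mulrC -mulrBr.
  case: ltngtP ir => // [|/ord_inj ->]; last by rewrite subrr mulr0 scale0r oppr0.
  by move=> ir _; rewrite -raise_coef_rec // -scaleNr -mulrN opprB.
have le_id : (i <= d)%N by rewrite -ltnS.
(* Only [g d.+1] survives, and it lies in [U_(d+1) = 0]. *)
rewrite telescope_sumr // /g ltn0 subr0 ltn_ord subSn //=.
rewrite (@split_nat_gt d.+1 (R _)) ?scaler0 //.
by have := R_split (leqnn d) (iter_R_ord (r := ord_max) le_id vU).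
Qed.

(** * The map [G] ([lower_eig]) with [G A = theta_j G] *)

Definition lower_eig (j : 'I_d.+1) : 'End(V) :=
  \sum_(s < d.+1 | (s <= j)%N)
    lower_coef j s *: (iter (j - s) (comp_lfun R) \1 \o F s)%VF.

(** Allowing [n > d] lets the formula apply to [R x] also when [x] is in [U_d]. *)
Lemma lower_eig_split (j : 'I_d.+1) (n : nat) x : x \in split_nat n ->
  lower_eig j x = if (n <= j)%N then lower_coef j n *: iter (j - n) R x else 0.
Proof.
move=> xU; have [nd|nd] := ltnP n d.+1; last first.
  by rewrite leqNgt (leq_trans (ltn_ord j) nd) (split_nat_gt nd xU) linear0.
have [k kn] : exists k : 'I_d.+1, k = n :> nat by exists (Ordinal nd).
rewrite -{n nd}kn in xU *.
have Fx (s : 'I_d.+1) : (lower_coef j s *: (iter (j - s) (comp_lfun R) \1 \o F s)%VF) x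
    = if s == k then lower_coef j k *: iter (j - k) R x else 0.
  rewrite scale_lfunE comp_lfunE; have [->|sk] := eqVneq s k.
    by rewrite F_id // iter_comp_lfunE.
  by rewrite (F_neq xU sk) linear0 scaler0.
rewrite /lower_eig sum_lfunE (eq_bigr _ (fun s _ => Fx s)) -big_mkcondr /=.
case: leqP => kj.
  by rewrite (big_pred1 k) // => s /=; case: eqP => [->|]; rewrite ?andbF ?kj.
by rewrite big_pred0 // => s; case: eqP => [->|]; rewrite ?andbF // leqNgt kj.
Qed.

Lemma lower_eigP (j : 'I_d.+1) x : (\sum_(l < d.+1) split_nat l)%VS = fullv ->
  lower_eig j (A x) = theta j *: lower_eig j x.
Proof.
move=> full; have : x \in fullv by rewrite memvf.
rewrite -full => /memv_sumP [u uU ->]; rewrite !linear_sum /=.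
apply: eq_bigr => s _; have xU := uU s isT; rewrite (A_split xU) linearD linearZ /=.
have RU : R (u s) \in split_nat s.+1 by apply: R_split xU; rewrite -ltnS.
rewrite (lower_eig_split _ xU) (lower_eig_split _ RU).
(* For [s = j], [R (u s)] lies in [U_(j+1)], which [G] kills. For [s < j] the two terms merge by the
   recursion of [lower_coef]; for [s > j] everything vanishes. *)
case: ltngtP => [sj|_|/ord_inj ->]; last by rewrite addr0.
  rewrite -lower_coef_rec // -iterSr -subSn // !scalerA -scalerDl.
  by congr (_ *: _); rewrite mulrBr addrC mulrC [_ * theta s]mulrC subrK mulrC.
by rewrite !scaler0 addr0.
Qed.

(** Computing [G (A x)] in two ways gives [theta_k G x = theta_j G x], and the eigenvalues are
    distinct. *)
Lemma lower_eig_limg (j k : 'I_d.+1) x :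
  (\sum_(l < d.+1) split_nat l)%VS = fullv ->
  k != j -> x \in limg (E k) -> lower_eig j x = 0.
Proof.
move=> full kj xE; have := lower_eigP j x full.
rewrite (limg_eig xE) linearZ /= => /eqP; rewrite -subr_eq0 -scalerBl scaler_eq0 subr_eq0.
by case/orP => [/eqP/theta_inj/eqP|/eqP //]; rewrite (negPf kj).
Qed.

(** * The vanishing of [G (As w)] and its expansion *)

Lemma lower_As_raise (i j : 'I_d.+1) v :
  (i + 2 <= j)%N -> v \in split_nat i -> lower_eig j (As (raise_eig i v)) = 0.
Proof.
(* The case [v = 0] is separate because [sum_split_full] needs a nonzero vector in some [U_k]. *)
move=> ij vU; have [->|v0] := eqVneq v 0.
  rewrite /raise_eig big1 ?linear0 // => r _.
  by rewrite -iter_comp_lfunE linear0 scaler0.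
have full := sum_split_full vU v0.
have wE : raise_eig i v \in limg (E i).
  by case: (theta_eig i) => _ -> _ _; apply/leigenspaceP/raise_eigP.
case: Phi => _ [_ [_ AsE]] _; have /(subvP (AsE i)) := memv_img As wE.
case/memv_sumP => u uE ->; rewrite linear_sum big1 // => k ki.
(* The components of [As w] have index [k <= i + 1 < j]. *)
apply: (lower_eig_limg full) (uE k ki); apply: contraTneq ij => <-.
by case/andP: ki => ki _; rewrite addn2 -ltnNge ltnS.
Qed.

Lemma split_relation (i j : 'I_d.+1) v :
  (i + 2 <= j)%N -> v \in split_nat i ->
  0 = \sum_(s < d.+1 | (i <= s <= j)%N)
        thetas s *: (lower_coef j s *:
          iter (j - s) R (raise_coef i s *: iter (s - i) R v))
    + \sum_(r < d.+1 | (i <= r)%N)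
        \sum_(s < d.+1 | (s <= j)%N && (r == s.+1 :> nat))
          lower_coef j s *: iter (j - s) R (L (raise_coef i r *: iter (r - i) R v)).
Proof.
move=> ij vU; rewrite -[LHS](lower_As_raise ij vU) /raise_eig !linear_sum.
rewrite big_mkcondr -big_split; apply: eq_bigr => r ir /=.
have xU := memvZ (raise_coef i r) (iter_R_ord ir vU).
(* From here [x] is the term of [w] in [U_r]; [As x] splits into [thetas_r x], giving the first sum,
   and [L x], giving the second. *)
move: (_ *: _) xU => x xU.
rewrite (As_split xU) linearD linearZ /= (lower_eig_split _ xU); congr (_ + _).
  by case: ifP; rewrite ?scaler0.
(* For [r = 0], [L] kills [U_0] and no [s] satisfies [r = s + 1]; otherwise only [s = n] can
   contribute, provided [n <= j]. *)
case def_r: (nat_of_ord r) xU => [|n] xU.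
  by rewrite (L_split0 xU) linear0 big_pred0 // => s; rewrite andbF.
have nd : (n < d)%N by rewrite -ltnS -def_r.
rewrite (lower_eig_split _ (L_split nd xU)).
case: leqP => nj; last first.
  by rewrite big_pred0 // => s; rewrite eqSS; case: eqP => [<-|]; rewrite ?andbF // leqNgt nj.
rewrite (big_pred1 (Ordinal (leqW nd))) // => s /=.
by rewrite eqSS -val_eqE /= eq_sym; case: eqP => [->|]; rewrite ?andbF ?nj.
Qed.

End TridiagonalSystem.

Theorem theorem9p2 (K : fieldType) (V : vectType K) (d : nat)
    (A : 'End(V)) (E : 'I_d.+1 -> 'End(V))
    (As : 'End(V)) (Es : 'I_d.+1 -> 'End(V))
    (theta thetas : 'I_d.+1 -> K) (F : 'I_d.+1 -> 'End(V)) (R L : 'End(V))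
    (V_neq0 : (0 < \dim {:V})%N)
    (d_ge1 : (1 <= d)%N)
    (Phi : tridiagonal_system A E As Es)
    (theta_eig : eigenvalue_sequence A E theta)
    (thetas_eig : eigenvalue_sequence As Es thetas)
    (F_proj : split_projections E Es F)
    (R_def : R = split_raising A theta F)
    (L_def : L = split_lowering As thetas F)
    (i j : 'I_d.+1) (ij : (i + 2 <= j)%N)
    (v : V) (vF : v \in limg (F i)) :
  0 =
    \sum_(s < d.+1 | (i <= s <= j)%N)
       thetas s *:
         ((\prod_(k < d.+1 | (s <= k < j)%N) (theta j - theta k))^-1 *:
            iter (j - s) R
              ((\prod_(k < d.+1 | (i < k <= s)%N) (theta i - theta k))^-1 *:
                 iter (s - i) R v))
  + \sum_(r < d.+1 | (i <= r)%N)
      \sum_(s < d.+1 | (s <= j)%N && (r == s.+1 :> nat))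
         (\prod_(k < d.+1 | (s <= k < j)%N) (theta j - theta k))^-1 *:
            iter (j - s) R
              (L ((\prod_(k < d.+1 | (i < k <= r)%N) (theta i - theta k))^-1 *:
                    iter (r - i) R v)).
Proof.
have vU : v \in split_nat E Es i by case: (F_proj i) vF => ->.
by rewrite R_def L_def; exact: split_relation Phi theta_eig thetas_eig F_proj _ _ _ ij vU.
Qed.
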